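(* Let $N', N_p \ge 1$, let $(Y_{exp}(t_i), t_i)$, $i=1,\dots,N'$, be real data pairs, let $f(\mathbf{P},t,k)$ be a real-valued function such that each $f(\cdot,t_i,\cdot)$ is $C^1$ in $(\mathbf{P},k)=(P_1,\dots,P_{N_p},k)$ on an open subset $W$ of $\mathbb{R}^{N_p+1}$, and let $\bar{\mathbf{P}}=(\bar P_1,\dots,\bar P_{N_p})$ be a $C^1$ function of $k$ on an open set $K\subseteq\mathbb{R}$ with $(\bar{\mathbf{P}}(k),k)\in W$ for all $k\in K$. Define $$Q_2(\mathbf{P},k)=\sum_{i=1}^{N'}\bigl(Y_{exp}(t_i)-f(\mathbf{P},t_i,k)\bigr)^2,\qquad Q_1(k)=Q_2(\bar{\mathbf{P}}(k),k).$$ Then: (1) If $(\mathbf{P},k)$ is a solution of the unconstrained least squares problem for $Q_2$ and $k=k'\in K$, $\mathbf{P}=\bar{\mathbf{P}}(k')$, then $k'$ is a solution of the constrained single-variable problem, i.e. $\frac{dQ_1}{dk}(k')=0$. (2) If $k'\in K$ is a solution of the constrained single-variable problem, i.e. $\frac{dQ_1}{dk}(k')=0$, then $(\bar{\mathbf{P}}(k'),k')$ is also a solution of the unconstrained problem for $Q_2$ if and only if $$\sum_{i=1}^{N'}\bigl(Y_{exp}(t_i)-f(\bar{\mathbf{P}}(k'),t_i,k')\bigr)\frac{\partial f}{\partial P_j}(\bar{\mathbf{P}}(k'),t_i,k')=0,\qquad j=1,2,\dots,N_p.$$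
   Context: A ''solution of the unconstrained least squares problem'' for $Q_2$ means a point $(\mathbf{P},k)\in W$ with all variables varied independently satisfying $\partial Q_2/\partial P_j=0$ for $j=1,\dots,N_p$ and $\partial Q_2/\partial k=0$. A ''solution of the constrained single-variable problem'' means a value $k'$ with $dQ_1/dk=0$ at $k'$. The function $\bar{\mathbf{P}}(k)$ may be any given $C^1$ function of $k$ (in the motivating case, an average over data subsets of implicit solutions of $Y_{exp}(t_i)=f(\mathbf{P},t_i,k)$). *)

(* Defs.v *)
From HB Require Import structures.
From mathcomp Require Import all_boot all_order all_algebra.
From mathcomp Require Import all_classical all_reals all_analysis.
Set Implicit Arguments. Unset Strict Implicit. Unset Printing Implicit Defensive.
Import Order.TTheory GRing.Theory Num.Theory.
Import numFieldNormedType.Exports.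
Local Open Scope classical_set_scope.
Local Open Scope ring_scope.

(* The space R^(n+1) of points (P, k) is
   'rV[R]_n * R, with its product (sup-norm) topology. *)

(* Coordinate directions: 'D_(dirP j) g and 'D_dirk g are the partial
   derivatives of g with respect to P_j and to k. *)
Definition dirP (R : realType) (n : nat) (j : 'I_n) : 'rV[R]_n * R :=
  (delta_mx 0 j, 0).

Definition dirk (R : realType) (n : nat) : 'rV[R]_n * R := (0, 1).

(* C^1 on an open set: all partial derivatives exist and are continuous there.
   Functions are total; values outside the (open) set play no role. *)
Definition C1_on (R : realType) (n : nat) (W : set ('rV[R]_n * R))
    (g : 'rV[R]_n * R -> R) : Prop :=
  forall p, W p ->
    [/\ forall j : 'I_n, derivable g p (dirP R j),
        derivable g p (dirk R n),
        forall j : 'I_n, {for p, continuous ('D_(dirP R j) g)} &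
        {for p, continuous ('D_(dirk R n) g)}].

Definition C1_curve_on (R : realType) (n : nat) (K : set R)
    (Pbar : R -> 'rV[R]_n) : Prop :=
  forall (j : 'I_n) (k : R), K k ->
    derivable (fun x => Pbar x 0 j) k 1 /\
    {for k, continuous (derive1 (fun x => Pbar x 0 j))}.

(* f(., t, .) as a function of the point (P, k). *)
Definition at_time (R : realType) (n : nat) (f : 'rV[R]_n -> R -> R -> R)
    (t : R) : 'rV[R]_n * R -> R :=
  fun p => f p.1 t p.2.

Definition Q2 (R : realType) (N n : nat) (Yexp t : 'I_N -> R)
    (f : 'rV[R]_n -> R -> R -> R) : 'rV[R]_n * R -> R :=
  fun p => \sum_(i < N) (Yexp i - f p.1 (t i) p.2) ^+ 2.

Definition Q1 (R : realType) (N n : nat) (Yexp t : 'I_N -> R)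
    (f : 'rV[R]_n -> R -> R -> R) (Pbar : R -> 'rV[R]_n) : R -> R :=
  fun k => Q2 Yexp t f (Pbar k, k).

(* [is_derive p v g 0]: the derivative exists and is 0; a bare ['D_v g p = 0]
   would say nothing where g is not derivable. *)
Definition unconstrained_solution (R : realType) (n : nat)
    (W : set ('rV[R]_n * R)) (Q : 'rV[R]_n * R -> R) (p : 'rV[R]_n * R)
    : Prop :=
  [/\ W p, forall j : 'I_n, is_derive p (dirP R j) Q 0 &
      is_derive p (dirk R n) Q 0].

Definition constrained_solution (R : realType) (Q : R -> R) (k : R) : Prop :=
  is_derive k 1 Q 0.

(* Main.v *)
(** A function whose partial derivatives exist near p and are continuous at p
    is differentiable at p: along the polygonal path from p to p + v that moves
    in one coordinate at a time, the mean value theorem bounds the error of the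
    linear approximation by e times the sum of the |v_i|. Hence Q2 is
    differentiable on W and the chain rule gives
    dQ1/dk = dQ2/dk + sum_j Pbar_j'(k) dQ2/dP_j, while
    dQ2/dP_j = -2 sum_i (Y_i - f) df/dP_j. Both claims follow. *)
Require Import Defs.
From HB Require Import structures.
From mathcomp Require Import all_boot all_order all_algebra.
From mathcomp Require Import all_classical all_reals all_analysis.
From mathcomp Require Import ring.
Import Order.TTheory GRing.Theory Num.Theory.
Import numFieldNormedType.Exports.
Local Open Scope classical_set_scope.
Local Open Scope ring_scope.

(** * Mean value estimates along lines and polygonal paths *)

Lemma is_derive_line {R : realType} (V : normedModType R) (g : V -> R)
    (p v : V) (s : R) :
  derivable g (s *: v + p) v ->
  is_derive s 1 (fun x : R => g (x *: v + p)) ('D_v g (s *: v + p)).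
Proof.
have E : (fun h : R => h^-1 *: (((fun x : R => g (x *: v + p)) \o shift s) (h *: 1)
            - g (s *: v + p)))
       = (fun h : R => h^-1 *: ((g \o shift (s *: v + p)) (h *: v) - g (s *: v + p))).
  by apply/funext => h; rewrite /= [h *: 1]mulr1 scalerDl addrA.
by move=> gv; split; rewrite /derivable /derive E.
Qed.

(** By the mean value theorem the increment is [h] times the derivative along [v] at some point of
    the segment, and there this derivative is within [e] of [a]. *)
Lemma line_increment {R : realType} (V : normedModType R) (g : V -> R)
    (p v : V) (h a e : R) :
  (forall s : R, `|s| <= `|h| ->
     derivable g (s *: v + p) v /\ `|'D_v g (s *: v + p) - a| <= e) ->
  `|g (h *: v + p) - g p - h * a| <= e * `|h|.
Proof.
move=> H; pose phi x := g (x *: v + p).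
have dphi (s : R) : `|s| <= `|h| -> is_derive s 1 phi ('D_v g (s *: v + p)).
  by move=> /H[gs _]; exact: is_derive_line.
have cphi (s : R) : `|s| <= `|h| -> {for s, continuous phi}.
  by move=> /dphi[ds _]; apply/differentiable_continuous/derivable1_diffP.
have [c ch E] : exists2 c, `|c| <= `|h| &
    phi h - phi 0 = 'D_v g (c *: v + p) * h.
  (* The mean value theorem wants ordered endpoints. For negative [h] it is applied on [[h, 0]], and
     both sides of the resulting equation change sign. *)
  have [h0|h0] := leP 0 h.
    have I (x : R) : x \in `[0, h]%R -> `|x| <= `|h|.
      by rewrite in_itv /= => /andP[x0 xh]; rewrite !ger0_norm.
    have [| |c c0h E] := @MVT_segment _ phi (fun s => 'D_v g (s *: v + p)) 0 h h0.
    - by move=> x /subset_itv_oo_cc/I/dphi.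
    - by apply: continuous_in_subspaceT => x; rewrite inE /= => /I/cphi.
    - by exists c; [exact: I|rewrite E subr0].
  have I (x : R) : x \in `[h, 0]%R -> `|x| <= `|h|.
    by rewrite in_itv /= => /andP[x0 xh]; rewrite !ler0_norm ?lerN2 // ltW.
  have [| |c c0h E] := @MVT_segment _ phi (fun s => 'D_v g (s *: v + p)) h 0 (ltW h0).
  - by move=> x /subset_itv_oo_cc/I/dphi.
  - by apply: continuous_in_subspaceT => x; rewrite inE /= => /I/cphi.
  - by exists c; [exact: I|rewrite -opprB E sub0r mulrN opprK].
have -> : g p = phi 0 by rewrite /phi scale0r add0r.
rewrite -/(phi h) E.
rewrite [h * a]mulrC -mulrBl normrM ler_wpM2r //.
by have [] := H _ ch.
Qed.

(** Induction on the list of moves: each move contributes the error of [line_increment], and the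
    errors add up. Bounding the total length of the path by [d] keeps every point of it in the ball
    where the hypothesis holds. *)
Lemma polygonal_increment {R : realType} (V : normedModType R) (I : Type)
    (u : I -> V) (a : I -> R) (g : V -> R) (p : V) (d e : R) (h : I -> R)
    (s : seq I) :
  (forall x : V, `|x - p| < d -> forall i,
     derivable g x (u i) /\ `|'D_(u i) g x - a i| <= e) ->
  \sum_(i <- s) `|h i *: u i| < d ->
  `|g (\sum_(i <- s) h i *: u i + p) - g p - \sum_(i <- s) h i * a i|
    <= e * \sum_(i <- s) `|h i|.
Proof.
move=> H; elim: s => [|i s IH].
  by rewrite !big_nil add0r !subrr normr0 mulr0.
rewrite !big_cons => sd; set q := \sum_(j <- s) h j *: u j + p.
have qd : \sum_(j <- s) `|h j *: u j| < d.
  by apply: le_lt_trans sd; rewrite lerDr.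
have := IH qd; rewrite -/q => Hq.
have Hi : `|g (h i *: u i + q) - g q - h i * a i| <= e * `|h i|.
  (* A point of the last segment is no farther from [p] than the length of the whole path, since [t]
     is at most [h i] in absolute value. *)
  apply: line_increment => t th; apply: H.
  rewrite /q addrA addrK; apply: le_lt_trans sd.
  rewrite (le_trans (ler_normD _ _)) // lerD //; last exact: ler_norm_sum.
  by rewrite !normrZ ler_wpM2r.
rewrite -[h i *: u i + _ + p]addrA -/q mulrDr.
set b := \sum_(j <- s) _ in Hq *.
rewrite (_ : _ - _ - _ = (g (h i *: u i + q) - g q - h i * a i) + (g q - g p - b)).
  by rewrite (le_trans (ler_normD _ _)) // lerD.
by ring.
Qed.

(** * Coordinates and linear forms on the space of points (P, k) *)

(* The index [None] stands for the last coordinate k, and [Some j] for P_j. *)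
Definition dir (R : realType) {n : nat} (i : option 'I_n) : 'rV[R]_n * R :=
  oapp (@dirP R n) (dirk R n) i.

Definition coord {R : realType} {n : nat} (i : option 'I_n)
    (v : 'rV[R]_n * R) : R :=
  oapp (fun j => v.1 0 j) v.2 i.

(** With the partial derivatives at a point as [a], this is the candidate for the differential
    there. *)
Definition gradient_form {R : realType} {n : nat} (a : option 'I_n -> R)
    (v : 'rV[R]_n * R) : R :=
  \sum_i coord i v * a i.

Lemma gradient_form_is_linear {R : realType} {n : nat} (a : option 'I_n -> R) :
  linear (gradient_form a).
Proof.
move=> k v w; rewrite /gradient_form scaler_sumr -big_split; apply: eq_bigr.
by move=> [j|] _ /=; rewrite ?mxE mulrDl [in RHS]/GRing.scale /= mulrA.
Qed.

HB.instance Definition _ (R : realType) (n : nat) (a : option 'I_n -> R) :=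
  GRing.isLinear.Build R _ _ _ _ (@gradient_form_is_linear R n a).

Lemma sum_coord_dir {R : realType} {n : nat} (v : 'rV[R]_n * R) :
  \sum_i coord i v *: dir R i = v.
Proof.
(* With the k-term split off, the remaining indices are exactly the [Some j], which leaves the
   standard expansion of a row vector. *)
rewrite (bigD1 None) //= (reindex_omap Some id) /=; last by case.
rewrite (eq_bigl xpredT) => [|j]; last by rewrite eqxx.
rewrite [v in RHS]surjective_pairing [v.1 in RHS]row_sum_delta.
rewrite /dir /= /dirk /dirP.
have -> : \sum_j v.1 0 j *: (delta_mx 0 j, 0) =
    (\sum_j v.1 0 j *: delta_mx 0 j, 0) :> 'rV[R]_n * R.
  elim/big_ind2 : _ => // [x y x' y' -> ->|j _].
    by congr pair; rewrite /= addr0.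
  by congr pair; rewrite /= scaler0.
by congr pair; rewrite /= ?scaler0 ?add0r ?addr0 // [LHS]mulr1.
Qed.

Lemma ler_norm_coord {R : realType} {n : nat} (i : option 'I_n)
    (v : 'rV[R]_n * R) :
  `|coord i v| <= `|v|.
Proof.
rewrite prod_normE le_max; case: i => [j|] /=; last by rewrite lexx orbT.
rewrite [`|v.1|]/Num.Def.normr /= mx_normrE.
by rewrite (le_trans _ (le_bigmax _ _ (0, j))).
Qed.

(** In the sup norm, the sum of the absolute values of the coefficients bounds the operator norm. *)
Lemma gradient_form_continuous {R : realType} {n : nat}
    (a : option 'I_n -> R) :
  continuous (gradient_form a).
Proof.
apply/linear_bounded_continuous/linear_boundedP.
exists (\sum_i `|a i|); split; first exact: num_real.
move=> r ar v; rewrite (le_trans (ler_norm_sum _ _ _)) //.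
apply: (@le_trans _ _ ((\sum_i `|a i|) * `|v|)).
  rewrite mulr_suml; apply: ler_sum => i _.
  by rewrite normrM mulrC ler_wpM2l // ler_norm_coord.
by rewrite ler_wpM2r // ltW.
Qed.

Lemma ler_norm_dir {R : realType} {n : nat} (i : option 'I_n) :
  `|dir R i| <= 1.
Proof.
rewrite prod_normE ge_max; case: i => [j|] /=.
  rewrite normr0 ler01 andbT [leLHS]/Num.Def.normr /= mx_normrE.
  apply: bigmax_le => // k _; rewrite !mxE.
  by case: (_ && _); rewrite ?normr1 ?normr0.
by rewrite normr0 normr1 ler01 lexx.
Qed.

(** * From continuous partial derivatives to differentiability *)

Lemma is_diff_near {K : numFieldType} {V W : normedModType K} (f : V -> W)
    (L : {linear V -> W}) (x : V) :
  continuous L ->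
  (forall e : K, 0 < e ->
    \forall v \near 0, `|f (v + x) - f x - L v| <= e * `|v|) ->
  is_diff x f L.
Proof.
move=> cL near_e.
have expansion : f \o shift x = cst (f x) + L +o_ 0 id.
  apply: (iffRL (eqaddoP _ _ _ _)) => e e0; near=> v.
  rewrite -[X in `|X| <= _]/(f (v + x) - (f x + L v)) opprD addrA.
  by near: v; exact: near_e.
(* A first-order expansion with a continuous linear part determines the differential, so ['d f x]
   can be replaced by [L]. *)
have dL := diff_unique cL expansion.
by split; [apply/diff_locallyP; rewrite dL|exact: dL].
Unshelve. all: by end_near. Qed.

Lemma C1_on_is_diff {R : realType} {n : nat} (W : set ('rV[R]_n * R))
    (g : 'rV[R]_n * R -> R) (p : 'rV[R]_n * R) :
  open W -> C1_on W g -> W p ->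
  is_diff p g (gradient_form (fun i => 'D_(dir R i) g p)).
Proof.
move=> oW C1g Wp.
have der x i : W x -> derivable g x (dir R i).
  by move=> /C1g[dP dk _ _]; case: i.
have cont i : {for p, continuous ('D_(dir R i) g)}.
  by have [_ _ cP ck] := C1g _ Wp; case: i.
apply: is_diff_near => [|e e0]; first exact: gradient_form_continuous.
(* The number of coordinates, n + 1. The sum of the |v_i| is at most [m] times the sup norm of [v],
   so a tolerance of [e / m] per direction gives a total error of at most [e * |v|]. *)
pose m : R := #|{: option 'I_n}|%:R.
have m0 : 0 < m by rewrite ltr0n card_option.
have em0 : 0 < e / m by rewrite divr_gt0.
have near_i i : \forall x \near p, derivable g x (dir R i) /\
    `|'D_(dir R i) g x - 'D_(dir R i) g p| <= e / m.
  near=> x; split; first by apply: der; near: x; exact: open_nbhs_nbhs.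
  rewrite distrC; near: x.
  exact: (cvgrPdist_le _ _).1 (cont i) _ em0.
(* There are finitely many directions, so one radius [d] serves them all. *)
have [d /= d0 near_p] := (nbhs_normP _ _).1 (filter_forall _ near_i); near=> v.
have norm_v : m * `|v| < d.
  rewrite mulrC -ltr_pdivlMr //; near: v.
  exact: (@nbhs0_lt _ ('rV[R]_n * R)%type) (divr_gt0 d0 m0).
have sum_norm : \sum_i `|coord i v| <= m * `|v|.
  rewrite /m -sum1_card natr_sum mulr_suml.
  by apply: ler_sum => i _; rewrite mul1r ler_norm_coord.
have := @polygonal_increment R _ _ (@dir R n)
  (fun i => 'D_(dir R i) g p) g p d (e / m) (coord^~ v) (index_enum _).
rewrite sum_coord_dir -/(gradient_form _ v) => inc.
apply: (le_trans (inc _ _)).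
- by move=> x xp i; apply: near_p; rewrite /ball_ /= distrC.
- apply: le_lt_trans norm_v; apply: le_trans sum_norm.
  by apply: ler_sum => i _; rewrite normrZ ler_piMr ?ler_norm_dir.
- by rewrite mulrAC ler_pdivrMr // -mulrA ler_pM2l // mulrC.
Unshelve. all: by end_near. Qed.

Lemma diff_partials {R : realType} {n : nat} (g : 'rV[R]_n * R -> R)
    (p v : 'rV[R]_n * R) :
  differentiable g p -> 'd g p v = \sum_i coord i v * 'D_(dir R i) g p.
Proof.
move=> dg; rewrite -{1}(sum_coord_dir v) linear_sum; apply: eq_bigr => i _.
by rewrite linearZ /= deriveE.
Qed.

(** * Derivatives of the sum of squares and the chain rule along a curve *)

Lemma Q2E {R : realType} {N n : nat} (Yexp t : 'I_N -> R)
    (f : 'rV[R]_n -> R -> R -> R) :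
  Q2 Yexp t f = \sum_(i < N) (cst (Yexp i) - at_time f (t i)) ^+ 2.
Proof. by apply/funext => x; rewrite fct_sumE. Qed.

Lemma is_derive_Q2 {R : realType} {N n : nat} (Yexp t : 'I_N -> R)
    (f : 'rV[R]_n -> R -> R -> R) (p v : 'rV[R]_n * R) :
  (forall i, derivable (at_time f (t i)) p v) ->
  is_derive p v (Q2 Yexp t f)
    (- 2 * \sum_(i < N) (Yexp i - f p.1 (t i) p.2) * 'D_v (at_time f (t i)) p).
Proof.
move=> df; rewrite Q2E mulr_sumr; apply: is_derive_sum => i.
have dfi := derivableP (df i).
apply: is_derive_eq; rewrite sub0r /GRing.scale /= expr1.
rewrite -[(cst _ - _) p]/(Yexp i - f p.1 (t i) p.2).
by rewrite mulrN !mulNr mulrA.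
Qed.

Lemma differentiable_Q2 {R : realType} {N n : nat} (Yexp t : 'I_N -> R)
    (f : 'rV[R]_n -> R -> R -> R) (p : 'rV[R]_n * R) :
  (forall i, differentiable (at_time f (t i)) p) ->
  differentiable (Q2 Yexp t f) p.
Proof.
move=> df; rewrite Q2E; apply: differentiable_sum => i.
by apply: differentiableX; apply: differentiableB.
Qed.

(** The chain rule for the curve x -> (c x, x), whose velocity is [('D_1 c k, 1)]; the last entry 1
    produces the partial derivative in k. *)
Lemma is_derive_comp_curve {R : realType} {n : nat} (Q : 'rV[R]_n * R -> R)
    (c : R -> 'rV[R]_n) (k : R) :
  differentiable Q (c k, k) -> (forall j, derivable (fun x => c x 0 j) k 1) ->
  is_derive k 1 (fun x => Q (c x, x))
    (\sum_i coord i ('D_1 c k, 1) * 'D_(dir R i) Q (c k, k)).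
Proof.
move=> dQ dc.
have {}dc : differentiable c k.
  by apply/derivable1_diffP/derivable_mxP => i j; rewrite ord1; exact: dc.
pose curve x := (c x, x).
have dcurve : differentiable curve k by exact: differentiable_pair.
have dQc : differentiable (Q \o curve) k by exact: differentiable_comp.
apply: DeriveDef; first exact/derivable1_diffP.
rewrite deriveE // diff_comp //= diff_pair //= diff_partials //.
by rewrite deriveE // diff_val.
Qed.

Lemma C1_on_differentiable {R : realType} {n : nat} (W : set ('rV[R]_n * R))
    (g : 'rV[R]_n * R -> R) (p : 'rV[R]_n * R) :
  open W -> C1_on W g -> W p -> differentiable g p.
Proof. by move=> oW C1g /(C1_on_is_diff _ _ _ oW C1g)[]. Qed.

(** * Comparison of the two least squares problems *)

Theorem theorem3 (R : realType) (N Np : nat) (hN : (1 <= N)%N) (hNp : (1 <= Np)%N)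
    (Yexp t : 'I_N -> R) (f : 'rV[R]_Np -> R -> R -> R)
    (W : set ('rV[R]_Np * R)) (hW : open W)
    (hf : forall i : 'I_N, C1_on W (at_time f (t i)))
    (K : set R) (hK : open K)
    (Pbar : R -> 'rV[R]_Np) (hPbar : C1_curve_on K Pbar)
    (hPW : forall k : R, K k -> W (Pbar k, k)) :
  (forall (P : 'rV[R]_Np) (k k' : R),
      unconstrained_solution W (Q2 Yexp t f) (P, k) ->
      k = k' -> K k' -> P = Pbar k' ->
      constrained_solution (Q1 Yexp t f Pbar) k')
  /\
  (forall k' : R, K k' ->
      constrained_solution (Q1 Yexp t f Pbar) k' ->
      (unconstrained_solution W (Q2 Yexp t f) (Pbar k', k') <->
       forall j : 'I_Np,
         \sum_(i < N) (Yexp i - f (Pbar k') (t i) k')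
            * 'D_(dirP R j) (at_time f (t i)) (Pbar k', k') = 0)).
Proof.
have diff_f k i : K k -> differentiable (at_time f (t i)) (Pbar k, k).
  by move=> /hPW; exact: C1_on_differentiable.
have diff_Q2 k : K k -> differentiable (Q2 Yexp t f) (Pbar k, k).
  by move=> Kk; apply: differentiable_Q2 => i; exact: diff_f.
have dQ1 k : K k -> is_derive k 1 (Q1 Yexp t f Pbar)
    (\sum_i coord i ('D_1 Pbar k, 1) * 'D_(dir R i) (Q2 Yexp t f) (Pbar k, k)).
  move=> Kk; apply: is_derive_comp_curve; first exact: diff_Q2.
  by move=> j; have [] := hPbar j k Kk.
have dQ2 k j : K k -> is_derive (Pbar k, k) (dirP R j) (Q2 Yexp t f)
    (- 2 * \sum_(i < N) (Yexp i - f (Pbar k) (t i) k)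
             * 'D_(dirP R j) (at_time f (t i)) (Pbar k, k)).
  move=> Kk; apply: is_derive_Q2 => i.
  by apply: diff_derivable; exact: diff_f.
split=> [P k0 k [_ dP dk] Ek Kk EP|k Kk dQ1k]; last split=> [[_ dP _] j|S0].
- rewrite {}EP {}Ek in dP dk.
  apply: is_derive_eq (dQ1 k Kk) _; apply: big1 => -[j|] _ /=.
    by rewrite derive_val mulr0.
  by rewrite derive_val mulr0.
(* The partial derivative in P_j is both 0 and -2 times the sum in question; the factor -2
   cancels. *)
- have /eqP := @derive_val _ _ _ _ _ _ _ (dP j).
  rewrite (@derive_val _ _ _ _ _ _ _ (dQ2 k j Kk)) mulf_eq0 oppr_eq0.
  by rewrite pnatr_eq0 => /eqP.
- have DP j : 'D_(dirP R j) (Q2 Yexp t f) (Pbar k, k) = 0.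
    by rewrite (@derive_val _ _ _ _ _ _ _ (dQ2 k j Kk)) S0 mulr0.
  have := @derive_val _ _ _ _ _ _ _ (dQ1 k Kk).
  (* The P_j-terms of the chain rule vanish, and the k-term has coefficient 1, so the partial
     derivative in k equals dQ1/dk = 0. *)
  rewrite (@derive_val _ _ _ _ _ _ _ dQ1k) (bigD1 None) //= mul1r.
  rewrite big1 ?addr0 => [Dk|[j|] //= _]; last by rewrite DP mulr0.
  split=> [|j|]; first exact: hPW.
  (* The derivative must also exist, which differentiability of [Q2] supplies. *)
  - by rewrite -(DP j); apply/derivableP/diff_derivable/diff_Q2.
  - by rewrite Dk; apply/derivableP/diff_derivable/diff_Q2.
Qed.
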